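(* Let $H:=(\mathbb{Z}/p^{\eta}\mathbb{Z},+)$ be endowed with the trivial linear cycle set structure and let $I:=\mathbb{Z}/p^{r}\mathbb{Z}$. Assume $\eta<r$ if $p$ is odd, and $(\eta,r)=(1,2)$ if $p=2$. Let $\diamond$ be an action of $H$ on $I$. Then there exists $0\le k<p^{\eta}$ such that $h\diamond y=(1+p^{r-\eta}k)^{h}y$. If $k\ne0$, write $k=p^{u}s$ with $0\le u<\eta$ and $p\nmid s$. In each of the following three cases, the indicated set of pairs $(f_0,\gamma)$ parametrizes a complete family $(\alpha_1(\gamma),f_{f_0})$ of representatives of 2-cocycles modulo coboundaries. ($k=0$) The set is $\{(p^{r-\eta}z_1,z_2):0\le z_1,z_2<p^{\eta}\}$. Moreover, $f_{f_0}(h,h')=f_0hh'$. ($k\ne0$ and $r+u\ge2\eta$) If $p\ne2$, the set is $\{(p^{r-\eta}(z_1-sz_2),p^{\eta-u}z_2):0\le z_1<p^{\eta}\text{ and }0\le z_2<p^{u}\}$. Moreover, $$h\diamond y=y+p^{r-\eta+u}shy\quad\text{and}\quad f_{f_0}(h,h')=f_0hh'.$$ If $p=2$, then $k=1$ and the set is $\{(2z_1-z_2,z_2):0\le z_1,z_2<2\}$. Moreover, $$h\diamond y=(1+2h)y\quad\text{and}\quad f_{f_0}(h,h')=f_0hh'.$$ ($k\ne0$ and $r+u<2\eta$) Then $p\ne2$ and the set is $\{(p^{r-\eta}sz_1,p^{\eta-u}(z_2-z_1)):0\le z_1<p^{u}\text{ and }0\le z_2<p^{r-\eta+u}\}$.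 Moreover, $$h\diamond y=\sum_{i=0}^{h}\binom{h}{i}p^{(r-\eta+u)i}s^{i}y\quad\text{and}\quad f_{f_0}(h,h')=\sum_{l=0}^{h-1}p^{(r-\eta+u)l}s^{l}\binom{h}{l+1}f_0h'.$$ (The formulas for $f_{f_0}$ are for $f_0$ occurring in the corresponding set.)
   Context: $p$ is a prime, $\eta\ge1$ and $r\ge1$ are integers. The trivial linear cycle set structure on $H$ is $i\cdot j:=j$. Elements $h,h'\in H$ are identified with their integer representatives in $\{0,\dots,p^{\eta}-1\}$; integers are viewed in $I$ through their classes, so each displayed set of pairs is a subset of $I\times I$. An action of $H$ on $I$ is a map $\diamond\colon H\times I\to I$ with $(h+h')\diamond y=h\diamond(h'\diamond y)$, $h\diamond(y+y')=h\diamond y+h\diamond y'$, $0\diamond y=y$. A 2-cocycle (for $\diamond$) is a pair $(\beta,f)$ of maps $H\times H\to I$, both vanishing when some argument is $0$, with $\beta$ symmetric, such that for all $a,b,c\in H$: $\beta(b,c)-\beta(a+b,c)+\beta(a,b+c)-\beta(a,b)=0$; $f(a,b+c)-f(a,b)-f(a,c)=a\diamond\beta(b,c)-\beta(b,c)$; $f(a+b,c)=b\diamond f(a,c)+f(b,c)$. It is a coboundary if there is $t\colon H\to I$ with $t(0)=0$, $\beta(a,b)=t(a)-t(a+b)+t(b)$ and $f(a,b)=t(b)-a\diamond t(b)$ for all $a,b$. The quotient group of 2-cocycles modulo coboundaries is $\operatorname{H}^2_\diamond(H,I)$. For $\gamma\in I$ and $0\le i,j<p^{\eta}$: $\alpha_1(\gamma)(i,j):=\gamma$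 if $i+j\ge p^{\eta}$, and $0$ otherwise. For $f_0\in I$: $f_{f_0}(h,h'):=h'\sum_{j=0}^{h-1}(j\diamond f_0)$ for $0\le h,h'<p^{\eta}$. A set $\Lambda\subseteq I\times I$ ''parametrizes a complete family $(\alpha_1(\gamma),f_{f_0})$ of representatives of 2-cocycles modulo coboundaries'' if $(\alpha_1(\gamma),f_{f_0})$ is a 2-cocycle for each $(f_0,\gamma)\in\Lambda$ and each class in $\operatorname{H}^2_\diamond(H,I)$ contains $(\alpha_1(\gamma),f_{f_0})$ for exactly one $(f_0,\gamma)\in\Lambda$. *)

(* Defs.v *)
From HB Require Import structures.
From mathcomp Require Import all_boot all_order all_fingroup all_algebra.

Set Implicit Arguments.
Unset Strict Implicit.
Unset Printing Implicit Defensive.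

Import GRing.Theory.
Local Open Scope ring_scope.

Record zmodAction (H I : zmodType) := ZmodAction {
  zact :> H -> I -> I;
  zactDl : forall h h' y, zact (h + h') y = zact h (zact h' y);
  zactDr : forall h y y', zact h (y + y') = zact h y + zact h y';
  zact0l : forall y, zact 0 y = y
}.

(* The pairs (beta, f) of maps H x H -> I, under pointwise addition.  They are
   made into a finGroupType, whose law is written multiplicatively, so that the
   cohomology group below can be an actual quotient of finite groups. *)
Definition cochain (H I : finZmodType) : Type :=
  ({ffun H * H -> I} * {ffun H * H -> I})%type.

HB.instance Definition _ (H I : finZmodType) := Finite.on (cochain H I).
HB.instance Definition _ (H I : finZmodType) := GRing.Zmodule.on (cochain H I).
HB.instance Definition _ (H I : finZmodType) :=
  [finGroupMixin of cochain H I for +%R].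

Section Cohomology.

Variables (H I : finZmodType) (dia : zmodAction H I).
Implicit Types (x : cochain H I) (t : {ffun H -> I}).

(* For a linear cycle set with trivial structure i . j := j on H. *)
Definition is_cocycle x : bool :=
  let beta a b := x.1 (a, b) in
  let f a b := x.2 (a, b) in
  [&& [forall a, (beta a 0 == 0) && (beta 0 a == 0)],
      [forall a, (f a 0 == 0) && (f 0 a == 0)],
      [forall a, forall b, beta a b == beta b a],
      [forall a, forall b, forall c,
        beta b c - beta (a + b) c + beta a (b + c) - beta a b == 0],
      [forall a, forall b, forall c,
        f a (b + c) - f a b - f a c == dia a (beta b c) - beta b c]
    & [forall a, forall b, forall c,
        f (a + b) c == dia b (f a c) + f b c]].

Definition Z2 : {set cochain H I} := [set x | is_cocycle x].

Definition coboundary t : cochain H I :=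
  ([ffun ab => t ab.1 - t (ab.1 + ab.2) + t ab.2],
   [ffun ab => t ab.2 - dia ab.1 (t ab.2)]).

Definition B2 : {set cochain H I} :=
  [set coboundary t | t : {ffun H -> I} & t 0 == 0].

Lemma zact0r h : dia h 0 = 0.
Proof. by apply: (addrI (dia h 0)); rewrite -zactDr !addr0. Qed.

Lemma mulg_cochainE x y : (x * y)%g = (x + y)%R :> cochain H I.
Proof. by []. Qed.

Lemma oneg_cochainE : 1%g = 0%R :> cochain H I.
Proof. by []. Qed.

Lemma is_cocycleP x :
  reflect [/\ (forall a, x.1 (a, 0) = 0 /\ x.1 (0, a) = 0),
              (forall a, x.2 (a, 0) = 0 /\ x.2 (0, a) = 0),
              (forall a b, x.1 (a, b) = x.1 (b, a)),
              (forall a b c, x.1 (b, c) - x.1 (a + b, c) + x.1 (a, b + c)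
                               - x.1 (a, b) = 0)
            & (forall a b c, x.2 (a, b + c) - x.2 (a, b) - x.2 (a, c)
                               = dia a (x.1 (b, c)) - x.1 (b, c))
              /\ (forall a b c, x.2 (a + b, c)
                               = dia b (x.2 (a, c)) + x.2 (b, c))]
          (is_cocycle x).
Proof.
apply: (iffP and5P) => [[h1 h2 h3 h4 /andP[h5 h6]]|[h1 h2 h3 h4 [h5 h6]]].
- split=> [a|a|a b|a b c|].
  + by case/andP: (forallP h1 a) => /eqP-> /eqP->.
  + by case/andP: (forallP h2 a) => /eqP-> /eqP->.
  + exact/eqP/(forallP (forallP h3 a) b).
  + exact/eqP/(forallP (forallP (forallP h4 a) b) c).
  + split=> a b c.
      exact/eqP/(forallP (forallP (forallP h5 a) b) c).
    exact/eqP/(forallP (forallP (forallP h6 a) b) c).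
- split; last (apply/andP; split).
  + by apply/forallP=> a; case: (h1 a) => -> ->; rewrite eqxx.
  + by apply/forallP=> a; case: (h2 a) => -> ->; rewrite eqxx.
  + by apply/forallP=> a; apply/forallP=> b; rewrite h3.
  + by do 3![apply/forallP=> ?]; apply/eqP/h4.
  + by do 3![apply/forallP=> ?]; apply/eqP/h5.
  + by do 3![apply/forallP=> ?]; apply/eqP/h6.
Qed.

Lemma Z2_group_set : group_set Z2.
Proof.
apply/group_setP; split.
  rewrite oneg_cochainE inE; apply/is_cocycleP.
  by split=> [a|a|a b|a b c|]; rewrite ?ffunE ?subr0 ?addr0 //;
     split=> a b c; rewrite !ffunE zact0r ?subr0 ?addr0.
move=> x y; rewrite !inE mulg_cochainE.
case/is_cocycleP=> [x1 x2 x3 x4 [x5 x6]].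
case/is_cocycleP=> [y1 y2 y3 y4 [y5 y6]].
apply/is_cocycleP; split=> [a|a|a b|a b c|].
- rewrite !ffunE; case: (x1 a) => -> ->; case: (y1 a) => -> ->.
  by rewrite addr0.
- rewrite !ffunE; case: (x2 a) => -> ->; case: (y2 a) => -> ->.
  by rewrite addr0.
- by rewrite !ffunE x3 y3.
- rewrite !ffunE !opprD.
  have := congr2 +%R (x4 a b c) (y4 a b c); rewrite addr0; apply: etrans.
  by rewrite [in RHS]addrACA; congr (_ + _); rewrite [in RHS]addrACA;
     congr (_ + _); rewrite [in RHS]addrACA.
- split=> a b c; rewrite !ffunE zactDr.
    rewrite !opprD.
    have := congr2 +%R (x5 a b c) (y5 a b c).
    rewrite [X in _ = X -> _]addrACA; apply: etrans.
    by rewrite [in RHS]addrACA; congr (_ + _); rewrite [in RHS]addrACA.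
  by rewrite x6 y6 addrACA.
Qed.

Canonical Z2_group := Group Z2_group_set.

Lemma B2_group_set : group_set B2.
Proof.
apply/group_setP; split.
  apply/imsetP; exists 0; first by rewrite inE ffunE.
  by rewrite oneg_cochainE; congr (_, _); apply/ffunP=> -[a b];
     rewrite !ffunE ?zact0r !subr0 ?addr0.
move=> _ _ /imsetP[t t0 ->] /imsetP[w w0 ->]; rewrite mulg_cochainE.
apply/imsetP; exists (t + w).
  by move: t0 w0; rewrite !inE ffunE => /eqP-> /eqP->; rewrite addr0.
congr (_, _); apply/ffunP=> -[a b]; rewrite !ffunE /= ?zactDr !opprD.
  by rewrite addrACA; congr (_ + _); rewrite addrACA.
by rewrite addrACA.
Qed.

Canonical B2_group := Group B2_group_set.

Definition H2 : {set coset_of B2} := (Z2 / B2)%g.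

End Cohomology.

(* In 'Z_n with 1 < n, the coercion to nat gives the representative
   in {0, ..., n - 1}. *)
Definition alpha1 (n m : nat) (gamma : 'Z_m) (i j : 'Z_n) : 'Z_m :=
  if (n <= (i : nat) + (j : nat))%N then gamma else 0.

Definition ff (n m : nat) (dia : zmodAction 'Z_n 'Z_m) (f0 : 'Z_m)
    (h h' : 'Z_n) : 'Z_m :=
  (\sum_(0 <= j < h) dia j%:R f0) *+ h'.

(* The pair l is (f_0, gamma), in this order. *)
Definition std_pair (n m : nat) (dia : zmodAction 'Z_n 'Z_m)
    (l : 'Z_m * 'Z_m) : cochain 'Z_n 'Z_m :=
  ([ffun ij => alpha1 l.2 ij.1 ij.2], [ffun ij => ff dia l.1 ij.1 ij.2]).

(* An element of H2 is a coset of B2, seen as a set of cochains by the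
   coercion from coset_of. *)
Definition complete_family (n m : nat) (dia : zmodAction 'Z_n 'Z_m)
    (Lambda : {set 'Z_m * 'Z_m}) : Prop :=
  (forall l, l \in Lambda -> std_pair dia l \in Z2 dia) /\
  (forall c : coset_of (B2 dia), c \in H2 dia ->
     exists! l, l \in Lambda /\ std_pair dia l \in (c : {set cochain 'Z_n 'Z_m})).

(* Main.v *)
(* Write n = p^eta, m = p^r, let g in I be the image of 1 under the action of
   1 in H, so that h acts as multiplication by g^h, and put q = g - 1.
   Subtracting the coboundary of t(c) = - sum_(j < c) beta(j, 1) turns any
   2-cocycle into some (alpha_1(gamma), f_(f0)); such a pair is a cocycle iff
   n f0 + q gamma = 0 and (1 + g + ... + g^(n-1)) f0 = 0, and it is a
   coboundary iff (f0, gamma) = (- q t, n t) for some t in I.  For p odd,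
   lifting the exponent shows that q is a multiple of p^(r - eta) and that
   1 + g + ... + g^(n-1) is n times a unit, so the cocycle condition decouples
   into n f0 = 0 and q gamma = 0.  With A = p^(r - eta), B = p^u and
   C = p^(eta - u) one has n = BC, m = ABC, q = ABs, and the cases of the
   theorem are C | A (with s = 0 and C = 1 when k = 0) and A | C.  If p = 2, k = 1,
   where the sum 1 + g vanishes in Z/4, the condition is f0 = gamma mod 2. *)
Require Import Defs.
From HB Require Import structures.
From mathcomp Require Import all_boot all_order all_fingroup all_algebra.
From mathcomp Require Import zify ring.

Set Implicit Arguments.
Unset Strict Implicit.
Unset Printing Implicit Defensive.

Import GRing.Theory.
Local Open Scope ring_scope.

(** * Geometric sums, truncated binomial expansions, and carries in Z/n *)

Lemma geomD (R : comPzRingType) (x : R) a b :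
  \sum_(i < a + b) x ^+ i = \sum_(i < a) x ^+ i + x ^+ a * \sum_(i < b) x ^+ i.
Proof.
rewrite big_split_ord /= mulr_sumr; congr (_ + _).
by apply: eq_bigr => i _; rewrite exprD.
Qed.

Lemma geom_binomial (R : comPzRingType) (q : R) h :
  \sum_(i < h) (1 + q) ^+ i = \sum_(0 <= i < h) q ^+ i *+ 'C(h, i.+1).
Proof.
elim: h => [|h IH]; first by rewrite big_ord0 big_geq.
rewrite big_ord_recr /= IH exprDn.
under [in RHS]eq_bigr do rewrite binS mulrnDr.
rewrite big_split /=; congr (_ + _).
  by rewrite big_nat_recr //= bin_small // mulr0n addr0.
by rewrite big_mkord; apply: eq_bigr => i _; rewrite expr1n mul1r.
Qed.

(** Every binomial term of degree at least 2 in [q] kills [y]. Asking this of [y] alone covers both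
    uses: [q] of square zero with [y] arbitrary, and [q] annihilating [y]. *)
Lemma exprD1_sqr0 (R : comPzRingType) (q y : R) h :
  q * q * y = 0 -> (1 + q) ^+ h * y = y + h%:R * q * y.
Proof.
move=> q2; elim: h => [|h IH]; first by rewrite expr0; ring.
rewrite exprS -mulrA IH -natr1.
transitivity (y + (h%:R + 1) * q * y + h%:R * (q * q * y)); first by ring.
by rewrite q2 mulr0 addr0.
Qed.

Lemma geom_mul_eq0 (R : comPzRingType) (q y : R) h :
  q * y = 0 -> (\sum_(i < h) (1 + q) ^+ i) * y = h%:R * y.
Proof.
move=> qy; rewrite mulr_suml.
have E (i : nat) : (1 + q) ^+ i * y = y.
  by rewrite exprD1_sqr0 -mulrA qy mulr0 ?addr0.
by under eq_bigr do rewrite E; rewrite sumr_const card_ord mulr_natl.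
Qed.

(** The carry, as a 0-1 integer, is [alpha1] with [gamma] equal to 1: up to the factor [n], it is
    the defect of additivity of the lift from Z/n to the integers. *)
Lemma val_ZpD n (a b : 'Z_n) : (1 < n)%N ->
  ((a : nat) + b = (a + b)%R + n * (n <= (a : nat) + b)%N)%N.
Proof.
move=> n_gt1; have lt_n (c : 'Z_n) : (c < n)%N by rewrite -{2}(Zp_cast n_gt1).
have -> : (a + b)%R = (((a : nat) + b) %% n)%N :> nat.
  by rewrite -val_Zp_nat // natrD !natr_Zp.
case: leqP => [le_n|lt]; last by rewrite modn_small // muln0 addn0.
have := lt_n a; have := lt_n b.
have -> : ((a : nat) + b = 1 * n + (a + b - n))%N by lia.
by rewrite modnMDl => ? ?; rewrite modn_small; lia.
Qed.

(** * Standard pairs: cocycle and coboundary criteria, and reduction of any cocycle to a standard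
    pair *)

Section StandardPairs.

Variables (n m : nat) (n_gt1 : (1 < n)%N) (m_gt1 : (1 < m)%N).
Variable dia : zmodAction 'Z_n 'Z_m.
Local Notation g := (dia 1 1).
Local Notation geom a := (\sum_(i < a) g ^+ i).

Lemma ltn_Zp (a : 'Z_n) : (a < n)%N.
Proof. by rewrite -{2}(Zp_cast n_gt1). Qed.

Lemma zact_mulr h y : dia h y = dia h 1 * y.
Proof.
rewrite -{1}(natr_Zp y) -{2}(natr_Zp y); elim: (y : nat) => [|k IH].
  by rewrite mulr0; exact: zact0r.
by rewrite -natr1 zactDr IH mulrDr mulr1.
Qed.

Lemma zact_nat k y : dia k%:R y = g ^+ k * y.
Proof.
elim: k y => [|k IH] y; first by rewrite zact0l expr0 mul1r.
by rewrite -natr1 zactDl IH (zact_mulr 1 y) mulrA -exprSr.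
Qed.

Lemma zactE h y : dia h y = g ^+ h * y.
Proof. by rewrite -{1}(natr_Zp h) zact_nat. Qed.

Lemma zact_exp_order : g ^+ n = 1.
Proof.
rewrite -[LHS]mulr1 -zact_nat.
have -> : n%:R = 0 :> 'Z_n by exact: (pchar_Zp n_gt1).
exact: zact0l.
Qed.

Lemma zact_expD (a b : 'Z_n) : g ^+ (a + b)%R = g ^+ a * g ^+ b.
Proof.
rewrite -exprD (val_ZpD a b n_gt1) exprD exprM zact_exp_order.
by rewrite expr1n mulr1.
Qed.

Lemma ffE f0 h h' : ff dia f0 h h' = geom h * f0 * h'%:R.
Proof.
rewrite /ff big_mkord -[LHS]mulr_natr; congr (_ * _); rewrite mulr_suml.
by apply: eq_bigr => i _; rewrite zact_nat.
Qed.

(** With [l] equal to (f_0, gamma), the first equation is the mixed condition relating f to beta at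
    the carry (n-1) + 1 = 0; the second says that f(a, c) returns to 0 after [n] unit steps in a. *)
Definition cocycle_param (l : 'Z_m * 'Z_m) : Prop :=
  n%:R * l.1 + (g - 1) * l.2 = 0 /\ geom n * l.1 = 0.

Lemma std_pair_cocycle l : cocycle_param l -> std_pair dia l \in Z2 dia.
Proof.
case: l => f0 gam [/= cond norm0]; rewrite inE; apply/is_cocycleP.
have alE (a b : 'Z_n) : alpha1 gam a b = (n <= (a : nat) + b)%N%:R * gam.
  by rewrite /alpha1; case: leqP; rewrite ?mul1r ?mul0r.
split=> /= [a|a|a b|a b c|].
- rewrite !ffunE /= !alE add0n addn0 leqNgt ltn_Zp.
  by rewrite mul0r.
- by rewrite !ffunE /= !ffE big_ord0 mulr0 !mul0r.
- by rewrite !ffunE /= !alE addnC.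
- rewrite !ffunE /= !alE.
  set c1 := leq n _; set c2 := leq n _; set c3 := leq n _; set c4 := leq n _.
  (* After multiplication by [n], each carry is a difference of integer representatives, and these
     differences telescope. *)
  have E : (c1 + c3 = c2 + c4)%N.
    apply/eqP; rewrite -(eqn_pmul2l (ltnW n_gt1)) !mulnDr; apply/eqP.
    have := val_ZpD b c n_gt1; have := val_ZpD (a + b) c n_gt1.
    have := val_ZpD a (b + c) n_gt1; have := val_ZpD a b n_gt1.
    rewrite addrA -/c1 -/c2 -/c3 -/c4.
    move: (n * c1)%N (n * c2)%N (n * c3)%N (n * c4)%N => k1 k2 k3 k4.
    move: (nat_of_ord (a + b)%R) (nat_of_ord (b + c)%R) => ab bc.
    by move: (nat_of_ord (a + b + c)%R); lia.
  have := congr1 (fun k => k%:R * gam : 'Z_m) E; rewrite !natrD !mulrDl => E'.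
  rewrite [LHS](_ : _ = c1%:R * gam + c3%:R * gam - (c2%:R * gam + c4%:R * gam)).
    by rewrite E' subrr.
  by ring.
- split=> a b c; rewrite !ffunE !ffE ?(zactE a) ?(zactE b) ?alE [fst _]/= [snd _]/=.
    have /(congr1 (fun k => k%:R : 'Z_m)) := val_ZpD b c n_gt1.
    rewrite !natrD natrM; set k := (leq n _)%:R => /eqP.
    rewrite addrC -subr_eq0 => /eqP E.
    have E1 := subrX1 g a.
    (* The expression is split along the three facts available: the carry identity for b + c, the
       first equation of [cocycle_param], and (g - 1) [geom a] = g^a - 1. *)
    transitivity (geom a * f0 * ((b + c)%R%:R + n%:R * k - (b%:R + c%:R))
                    - geom a * k * (n%:R * f0 + (g - 1) * gam)
                    + (g - 1) * geom a * (k * gam)).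
      by ring.
    have -> : (b + c)%R%:R + n%:R * k - (b%:R + c%:R) = 0 :> 'Z_m.
      by apply/oppr_inj; rewrite oppr0 -E; ring.
    by rewrite cond -E1; ring.
  rewrite mulrA -mulrDl mulrA -mulrDl; congr (_ * _).
  (* If a + b wraps around, the two geometric sums differ by a power of g times [geom n], which
     kills f_0. *)
  have -> : geom (a + b)%R * f0 = geom ((a : nat) + b)%N * f0.
    rewrite (val_ZpD a b n_gt1) geomD mulrDl; case: (_ <= _)%N.
      by rewrite muln1 -mulrA norm0 mulr0 addr0.
    by rewrite muln0 big_ord0 mulr0 mul0r addr0.
  by rewrite addnC geomD; ring.
Qed.

Lemma coboundary_cocycle (t : {ffun 'Z_n -> 'Z_m}) :
  t 0 = 0 -> coboundary dia t \in Z2 dia.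
Proof.
move=> t0; rewrite inE; apply/is_cocycleP; split=> [a|a|a b|a b c|].
- by rewrite !ffunE /= add0r addr0 t0 add0r addr0 subrr addNr.
- by rewrite !ffunE /= t0 zact0r subr0 zact0l subrr.
- by rewrite !ffunE /= (addrC a b); ring.
- by rewrite !ffunE /= (addrA a b c); ring.
- split=> a b c; rewrite !ffunE [fst _]/= [snd _]/=.
    by rewrite !(zactE a); ring.
  by rewrite (zactE a) !(zactE b) (zactE (a + b)) zact_expD; ring.
Qed.

(** Since [alpha1] vanishes at (k, 1) for k + 1 < n, a cochain t bounding a standard pair satisfies
    t(k) = k t(1) on representatives; its value at (n-1, 1) then gives gamma = n t(1), and f(1, 1)
    gives f_0. *)
Lemma std_pair_coboundary l :
  std_pair dia l \in B2 dia <-> exists t, l = ((1 - g) * t, n%:R * t).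
Proof.
have val1 : (1 : 'Z_n) = 1%N :> nat by [].
split=> [/imsetP[t]|[t ->]].
  rewrite inE => /eqP t0 E.
  have al (a b : 'Z_n) : alpha1 l.2 a b = t a - t (a + b) + t b.
    by have /(congr1 (fun x : cochain 'Z_n 'Z_m => x.1 (a, b))) := E; rewrite !ffunE.
  have f1 : l.1 = (1 - g) * t 1.
    have /(congr1 (fun x : cochain 'Z_n 'Z_m => x.2 (1, 1))) := E.
    rewrite !ffunE [fst _]/= [snd _]/= ffE val1 big_ord1 mul1r mulr1 => ->.
    by rewrite (zact_mulr 1 (t 1)) mulrBl mul1r.
  have tE k : (k < n)%N -> t k%:R = k%:R * t 1.
    elim: k => [|k IH] lt_kn; first by rewrite t0 mul0r.
    have := al k%:R 1; rewrite /alpha1 val1 val_Zp_nat // modn_small ?(ltnW lt_kn) //.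
    rewrite addn1 leqNgt lt_kn /= natr1 (IH (ltnW lt_kn)) => /eqP.
    by rewrite eq_sym addrAC subr_eq0 => /eqP <-; rewrite -natr1; ring.
  exists (t 1); rewrite -f1 [l in LHS]surjective_pairing; congr (_, _).
  have lt : (n.-1 < n)%N by rewrite prednK // ltnW.
  have := al n.-1%:R 1; rewrite /alpha1 val1 val_Zp_nat // modn_small //.
  rewrite addn1 prednK ?(ltnW n_gt1) // leqnn natr1 prednK ?(ltnW n_gt1) //.
  rewrite (pchar_Zp n_gt1) t0 subr0 tE // => ->.
  have -> : n%:R = n.-1%:R + 1 :> 'Z_m by rewrite natr1 prednK // ltnW.
  by ring.
(* Multiplication of the integer representative by [t]: not additive on Z/n, its defect being the
   carry times n t. *)
apply/imsetP; exists [ffun a : 'Z_n => (a : nat)%:R * t].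
  by rewrite inE ffunE mul0r.
congr (_, _); apply/ffunP=> -[a b]; rewrite !ffunE [fst _]/= [snd _]/=.
  have /(congr1 (fun k => k%:R : 'Z_m)) := val_ZpD a b n_gt1.
  rewrite /alpha1 !natrD natrM => E.
  transitivity ((a%:R + b%:R - (a + b)%R%:R) * t); last by ring.
  by rewrite E; case: (_ <= _)%N => /=; ring.
rewrite (zactE a) ffE.
by have := subrX1 g a => E; transitivity (- (g ^+ a - 1) * (b%:R * t));
  [rewrite E|]; ring.
Qed.

Lemma std_pairB l l' : std_pair dia (l - l') = std_pair dia l - std_pair dia l'.
Proof.
congr (_, _); apply/ffunP=> -[a b]; rewrite !ffunE [fst _]/= [snd _]/=.
  by rewrite /alpha1; case: leqP => _; rewrite ?subr0.
by rewrite !ffE mulrBr mulrBl.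
Qed.

Lemma cocycle_std_pair x : x \in Z2 dia ->
  exists2 l, cocycle_param l & x - std_pair dia l \in B2 dia.
Proof.
move=> Zx; have val1 : (1 : 'Z_n) = 1%N :> nat by [].
have [t tE] : exists t : {ffun 'Z_n -> 'Z_m},
    forall c, t c = - \sum_(j < c) x.1 (j%:R, 1).
  by exists [ffun c : 'Z_n => - \sum_(j < c) x.1 (j%:R, 1)] => c; rewrite ffunE.
have t0 : t 0 = 0 by rewrite tE big_ord0 oppr0.
have [y yE] : exists y, y = x - coboundary dia t by exists (x - coboundary dia t).
have xy : x - y \in B2 dia.
  by rewrite yE opprB addrC subrK; apply/imsetP; exists t; rewrite ?inE ?t0.
have Zy : y \in Z2 dia.
  have -> : y = (x * (coboundary dia t)^-1)%g by [].
  by rewrite groupM ?groupV ?coboundary_cocycle.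
have x01 : x.1 (0, 1) = 0.
  by move: Zx; rewrite inE => /is_cocycleP[/(_ 1)[]].
(* The function [t] consists of negated partial sums of x.1(j, 1), so t(c) - t(c+1) = x.1(c, 1) as
   long as c + 1 does not wrap around, while t(1) = 0. *)
have y1 (c : 'Z_n) : (c.+1 < n)%N -> y.1 (c, 1) = 0.
  have -> : y.1 (c, 1) = x.1 (c, 1) - (t c - t (c + 1) + t 1).
    by rewrite yE !ffunE.
  move=> lt; rewrite !tE val1 big_ord1 x01 oppr0 addr0.
  have -> : (c + 1)%R = c.+1 :> nat.
    by have := val_ZpD c 1 n_gt1; rewrite val1 addn1 leqNgt lt muln0 addn0 => <-.
  by rewrite big_ord_recr /= natr_Zp; ring.
move: Zy; rewrite inE => /is_cocycleP[z1 z2 z3 z4 [z5 z6]].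
have yn (c : 'Z_n) : c.+1 = n -> y.1 (c, 1) = y.1 (-1, 1).
  move=> E; congr (y.1 (_, _)); apply/eqP; rewrite -addr_eq0; apply/eqP.
  by rewrite -(natr_Zp c) natr1 E pchar_Zp.
(* The only value of y.1(c, 1) that may survive is the one at c = n - 1, that is, at -1. *)
pose gam := y.1 (-1, 1).
have yal a b : y.1 (a, b) = alpha1 gam a b.
  rewrite -(natr_Zp b); have := ltn_Zp b; elim: (b : nat) => [|k IH] lt.
    by rewrite (z1 a).1 /alpha1 addn0 leqNgt ltn_Zp.
  have lt' := ltnW lt; have kE : (k%:R : 'Z_n) = k :> nat.
    by rewrite val_Zp_nat // modn_small.
  (* The cocycle identity at (a, k, 1), where y.1(k, 1) = 0, advances the second argument by one;
     the increment is [gam] exactly when a + k is -1 in Z/n, which is when the carry appears. *)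
  have step : y.1 (a, k.+1%:R) = alpha1 gam a k%:R + y.1 (a + k%:R, 1).
    rewrite -IH // -natr1; have /eqP := z4 a k%:R 1.
    rewrite (y1 k%:R) ?kE // sub0r subr_eq0 => /eqP <-.
    by rewrite addrAC addNr add0r.
  rewrite step /alpha1 kE val_Zp_nat // modn_small //.
  have := val_ZpD a k%:R n_gt1; rewrite kE addnS.
  have := ltn_Zp (a + k%:R); case: (leqP n (a + k)) => le_n ltc E.
    rewrite leqW // y1 ?addr0 //; move: E (ltn_Zp a) lt; rewrite muln1.
    by move: (nat_of_ord (a + k%:R)); lia.
  rewrite muln0 addn0 in E; rewrite add0r.
  case: leqP => le_n'; last by rewrite y1 -?E.
  by rewrite yn // -E; apply/anti_leq; rewrite le_n le_n'.
pose f0 := y.2 (1, 1).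
(* The defect of additivity of y.2(1, _) at (k, 1) is (g - 1) y.1(k, 1), which is 0 before the
   carry. *)
have y2_1 (c : 'Z_n) : y.2 (1, c) = c%:R * f0.
  rewrite -{1}(natr_Zp c); have := ltn_Zp c; elim: (c : nat) => [|k IH] lt.
    by rewrite (z2 1).1 mul0r.
  have := z5 1 k%:R 1; rewrite natr1 yal /alpha1 val1 val_Zp_nat //.
  rewrite modn_small ?(ltnW lt) // addn1 leqNgt lt /= zact0r subr0 -addrA -opprD.
  by move/eqP; rewrite subr_eq0 IH ?(ltnW lt) // => /eqP ->; rewrite -/f0 -natr1; ring.
have y2E (a c : 'Z_n) : y.2 (a, c) = geom a * f0 * c%:R.
  rewrite -{1}(natr_Zp a); have := ltn_Zp a; elim: (a : nat) => [|k IH] lt.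
    by rewrite (z2 c).2 big_ord0 !mul0r.
  rewrite -nat1r z6 zact_nat y2_1 IH ?(ltnW lt) // big_ord_recr /=; ring.
have lt1 : (n.-1 < n)%N by rewrite prednK // ltnW.
have n1 : (n.-1%:R + 1 : 'Z_n) = 0 by rewrite natr1 prednK ?pchar_Zp // ltnW.
have valn1 : (n.-1%:R : 'Z_n) = n.-1 :> nat by rewrite val_Zp_nat ?modn_small.
exists (f0, gam); first split => /=.
- have := z5 1 n.-1%:R 1; rewrite n1 (z2 1).1 !y2_1 yal /alpha1 valn1 val1.
  rewrite addn1 prednK ?(ltnW n_gt1) // leqnn (zact_mulr 1 gam) mul1r => E.
  have -> : n%:R = n.-1%:R + 1 :> 'Z_m by rewrite natr1 prednK // ltnW.
  transitivity (g * gam - gam - (0 - n.-1%:R * f0 - f0)); first by ring.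
  by rewrite E subrr.
- have geomS k : (0 < k)%N -> geom k = geom k.-1 + g ^+ k.-1.
    by case: k => // k _; rewrite big_ord_recr.
  have := z6 1 n.-1%:R 1; rewrite addrC n1 (z2 1).2 zact_nat !y2E.
  rewrite valn1 val1 big_ord1 expr0.
  by rewrite (geomS n) ?(ltnW n_gt1) // => E; rewrite [RHS]E; ring.
have -> : std_pair dia (f0, gam) = y; last by [].
rewrite [y]surjective_pairing; congr (_, _); apply/ffunP=> -[a b]; rewrite !ffunE.
  by rewrite yal.
by rewrite y2E ffE.
Qed.

Definition cohomologous (l l' : 'Z_m * 'Z_m) : Prop :=
  exists t, l.1 = l'.1 + (1 - g) * t /\ l.2 = l'.2 + n%:R * t.

Lemma cohomologousP l l' :
  cohomologous l l' <-> std_pair dia l - std_pair dia l' \in B2 dia.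
Proof.
rewrite -std_pairB; split=> [[t [e1 e2]]|/std_pair_coboundary[t E]].
  apply/std_pair_coboundary; exists t.
  by rewrite [LHS]surjective_pairing /= e1 e2 !(addrC l'.1) !(addrC l'.2) !addrK.
exists t; have /(congr1 fst)/= <- := E; have /(congr1 snd)/= <- := E.
by rewrite !subrKC.
Qed.

(** Every coset meets the standard pairs, by [cocycle_std_pair], so cochains can be forgotten: what
    remains is to exhibit a transversal of [cohomologous] on the pairs satisfying
    [cocycle_param]. *)
Lemma complete_family_cohomologous (Lambda : {set 'Z_m * 'Z_m}) :
    (forall l, l \in Lambda -> cocycle_param l) ->
    (forall l, cocycle_param l -> exists2 l', l' \in Lambda & cohomologous l l') ->
    {in Lambda &, forall l l', cohomologous l l' -> l = l'} ->
  complete_family dia Lambda.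
Proof.
move=> param surj inj; split=> [l /param|c]; first exact: std_pair_cocycle.
case/morphimP=> x Nx Zx ->.
have memE y : (y \in (coset (B2 dia) x : {set _})) = (y - x \in B2 dia).
  by rewrite val_coset // mem_rcoset.
have [l /surj[l' Ll' ll'] xl] := cocycle_std_pair Zx.
have xl' : std_pair dia l' - x \in B2 dia.
  have B : (x - std_pair dia l) + (std_pair dia l - std_pair dia l') \in B2 dia.
    by apply: (groupM xl); apply/cohomologousP.
  by rewrite addrA subrK in B; rewrite -opprB; apply: groupVr.
exists l'; split=> [|l2 [Ll2]]; rewrite memE // => l2x.
apply: inj => //; apply/cohomologousP.
have : (std_pair dia l' - x) + - (std_pair dia l2 - x) \in B2 dia.
  by apply: groupM => //; apply: groupVr.
by rewrite opprB addrA subrK.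
Qed.

End StandardPairs.

(** * Lifting the exponent for odd primes *)

Lemma expn1D_cubic (x k : nat) :
  exists c, ((1 + x) ^ k = 1 + k * x + 'C(k, 2) * x ^ 2 + c * x ^ 3)%N.
Proof.
elim: k => [|k [c IH]]; first by exists 0%N.
exists ('C(k, 2) + c + c * x)%N; rewrite expnS IH binS bin1; ring.
Qed.

(** Induction on [j]: with x of valuation d >= 1, in (1 + x)^p the term p x has valuation d + 1,
    whereas the quadratic term (as p divides 'C(p, 2) for odd p) and the cubic remainder are
    divisible by p^(d+2). *)
Lemma lifting_exponent p e w j : prime p -> odd p -> (0 < e)%N -> ~~ (p %| w)%N ->
  exists2 w', ((1 + p ^ e * w) ^ (p ^ j) = 1 + p ^ (e + j) * w')%N & ~~ (p %| w')%N.
Proof.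
move=> p_pr p_odd e_gt0 pw; elim: j => [|j [w1 IH pw1]].
  by exists w => //; rewrite expn0 expn1 addn0.
rewrite expnSr expnM IH; have [c ->] := expn1D_cubic (p ^ (e + j) * w1) p.
have pb : (p %| 'C(p, 2))%N by apply: prime_dvd_bin => //=; exact: odd_prime_gt2.
case/dvdnP: pb => b ->; set d := (e + j)%N.
(* Writing d = i + 1 makes the exponents 2d + 1 = (d + 2) + i and 3d = (d + 2) + 2i free of
   subtraction. *)
have -> : (e + j.+1 = d.-1.+2)%N by rewrite /d; lia.
have {IH} -> : d = d.-1.+1 by rewrite /d; lia.
rewrite /=; set i := d.-1.
exists (w1 + p * (b * p ^ i * w1 ^ 2 + c * p ^ (i + i) * w1 ^ 3))%N.
  by rewrite !expnS expnD; ring.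
by rewrite dvdn_addl // dvdn_mulr.
Qed.

(** In x G = (1 + x)^(p^j) - 1 the valuations of x and of the right-hand side are e and e + j, so
    that of the sum G is exactly j. *)
Lemma geom_prime_power p e w j : prime p -> odd p -> (0 < e)%N -> ~~ (p %| w)%N ->
  exists2 w', (\sum_(i < p ^ j) (1 + p ^ e * w) ^ i = p ^ j * w')%N & ~~ (p %| w')%N.
Proof.
move=> p_pr p_odd e_gt0 pw.
have [w1 E pw1] := lifting_exponent j p_pr p_odd e_gt0 pw.
have := predn_exp (1 + p ^ e * w) (p ^ j); rewrite E !add1n /= expnD -!mulnA.
move/eqP; rewrite eqn_pmul2l ?expn_gt0 ?prime_gt0 //; set G := (\sum_(i < _) _)%N.
move=> /eqP E1; have : (p ^ j %| w * G)%N by rewrite -E1 dvdn_mulr.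
rewrite Gauss_dvdr ?coprimeXl ?prime_coprime // => /dvdnP[w2 GE].
exists w2; first by rewrite GE mulnC.
apply: contra pw1; move: E1; rewrite GE mulnA [in X in X -> _]mulnC => /eqP.
rewrite eqn_pmul2r ?expn_gt0 ?prime_gt0 // => /eqP ->; exact: dvdn_mull.
Qed.

Lemma modn_exp_prime_power p a j : prime p -> (a ^ (p ^ j) = a %[mod p])%N.
Proof.
move=> p_pr; elim: j => [|j IH]; first by rewrite expn0 expn1.
by rewrite expnSr expnM -modnXm IH modnXm fermat_little.
Qed.

(** By Fermat, a is 1 mod p, so lifting the exponent applies: if a - 1 has valuation e, then a^(p^j)
    - 1 has valuation e + j, which must reach r. *)
Lemma dvdn_pred_expn_eq1 p a j r : prime p -> odd p -> (0 < a)%N -> (j < r)%N ->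
  (a ^ (p ^ j) = 1 %[mod p ^ r])%N -> (p ^ (r - j) %| a.-1)%N.
Proof.
move=> p_pr p_odd a_gt0 lt_jr.
case: (posnP a.-1) => [->|x_gt0]; first by rewrite dvdn0.
have aE : a = (1 + a.-1)%N by rewrite add1n prednK.
move=> E; have Ea : (1 + a.-1 = 1 + 0 %[mod p])%N.
  rewrite -aE addn0 -(modn_exp_prime_power a j p_pr).
  have pr : (p %| p ^ r)%N by rewrite dvdn_exp // (leq_trans _ lt_jr).
  by rewrite -(modn_dvdm _ pr) E modn_dvdm.
have p_x : (p %| a.-1)%N by move/eqP: Ea; rewrite eqn_modDl mod0n.
have [w co xE] := pfactor_coprime p_pr x_gt0.
set e := logn p a.-1 in xE; have e_gt0 : (0 < e)%N.
  by rewrite /e -(pfactor_dvdn 1) // expn1.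
have pw : ~~ (p %| w)%N by rewrite -prime_coprime.
have [w' E' pw'] := lifting_exponent j p_pr p_odd e_gt0 pw.
rewrite xE dvdn_mull // dvdn_exp2l // leq_subLR addnC.
move: E; rewrite aE xE mulnC E' => /eqP; rewrite -[X in _ == X %[mod _]]addn0.
rewrite eqn_modDl mod0n -/(dvdn _ _); have [//|lt] := leqP r (e + j).
rewrite -(subnKC (ltnW lt)) (expnD p (e + j)) dvdn_pmul2l ?expn_gt0 ?prime_gt0 //.
move=> dv; case/negP: pw'; apply: dvdn_trans dv; rewrite dvdn_exp // subn_gt0 //.
Qed.

(** * Equalities in Z/m as divisibilities between integers *)

Lemma dvdz_eqr (d x y : int) : (d %| x)%Z -> y = x -> (d %| y)%Z.
Proof. by move=> dx ->. Qed.

Lemma Zp_intr_eq m (a b : int) : (1 < m)%N ->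
  a%:~R = b%:~R :> 'Z_m <-> (m %| a - b)%Z.
Proof.
move=> m_gt1; have natP (k : nat) : k%:R = 0 :> 'Z_m <-> (m %| k)%N.
  split=> [/(congr1 (@nat_of_ord _))|/dvdnP[d ->]].
    by rewrite val_Zp_nat // => /eqP.
  by rewrite natrM (pchar_Zp m_gt1) mulr0.
suff dvdP (c : int) : c%:~R = 0 :> 'Z_m <-> (m %| c)%Z.
  by rewrite -dvdP intrB; split=> [->|/eqP]; rewrite ?subrr ?subr_eq0 // => /eqP.
rewrite dvdzE absz_nat -natP; case: c => k; first by rewrite -pmulrn.
rewrite NegzE abszN absz_nat mulrNz -pmulrn.
by split=> [/eqP|->]; rewrite ?oppr_eq0 ?oppr0 // => /eqP.
Qed.

Lemma dvdz_ord_inj n (i j : 'I_n) : (n %| (i : int) - (j : int))%Z -> i = j.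
Proof.
rewrite -eqz_mod_dvd => /eqP; rewrite !modz_nat => -[].
by rewrite !modn_small // => /val_inj.
Qed.

Lemma int_ord_repr n (x : int) : (0 < n)%N ->
  exists (i : 'I_n) (d : int), x = i%:Z + n%:Z * d.
Proof.
move=> n_gt0; have n0 : n%:Z != 0 by case: n n_gt0.
have lt : (`|(x %% n)%Z| < n)%N.
  by rewrite -ltz_nat gez0_abs ?modz_ge0 // ltz_mod.
exists (Ordinal lt), (x %/ n)%Z.
by rewrite /= gez0_abs ?modz_ge0 // addrC mulrC -divz_eq.
Qed.

Lemma Zp_int m (y : 'Z_m) : exists k : int, y = k%:~R.
Proof. by exists (y : nat); rewrite -pmulrn natr_Zp. Qed.

(** * Transversals for the moduli n = BC and m = ABC, with q = ABs *)

Section Families.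

Variables (n m A B C s : nat).
Hypotheses (n_gt1 : (1 < n)%N) (m_gt1 : (1 < m)%N).
Hypotheses (nE : n = (B * C)%N) (mE : m = (A * B * C)%N).
Variable dia : zmodAction 'Z_n 'Z_m.
Hypothesis gE : dia 1 1 = 1 + (A * B * s)%:R.
Hypothesis paramE : forall l, cocycle_param dia l <->
  n%:R * l.1 = 0 /\ (dia 1 1 - 1) * l.2 = 0.
Hypothesis annC : forall y : 'Z_m,
  (A * B * s)%:R * y = 0 -> exists v : int, y = (C%:Z * v)%:~R.

Lemma ABC_gt0 : [/\ (0 < A)%N, (0 < B)%N & (0 < C)%N].
Proof. by have := ltnW m_gt1; rewrite mE !muln_gt0 => /andP[/andP[]]. Qed.

Lemma ABC_neq0 : [/\ A%:Z != 0, B%:Z != 0 & C%:Z != 0].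
Proof. by have [a b c] := ABC_gt0; rewrite !eqz_nat -!lt0n. Qed.

Lemma annA (y : 'Z_m) : n%:R * y = 0 -> exists v : int, y = (A%:Z * v)%:~R.
Proof.
have [A0 B0 C0] := ABC_neq0; have [k ->] := Zp_int y.
rewrite pmulrn -intrM => /(Zp_intr_eq _ 0 m_gt1).
have -> : m%:Z = n%:Z * A%:Z by rewrite mE nE !PoszM; ring.
rewrite subr0 dvdz_mul2l; last by rewrite nE PoszM mulf_neq0.
by case/dvdzP => v ->; exists v; rewrite mulrC.
Qed.

Lemma cohomologous_intr (a b c d t : int) :
    (m %| a - c + A%:Z * B%:Z * s%:Z * t)%Z -> (m %| b - d - B%:Z * C%:Z * t)%Z ->
  cohomologous dia (a%:~R, b%:~R) (c%:~R, d%:~R).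
Proof.
move=> h1 h2; exists t%:~R; rewrite gE /= pmulrn [n%:R]pmulrn.
have -> : 1 - (1 + (A * B * s)%N%:~R) = (- (A * B * s)%:Z)%:~R :> 'Z_m.
  by rewrite intrN; ring.
rewrite -!intrM -!intrD; split; apply/Zp_intr_eq => //.
  by apply: (dvdz_eqr h1); rewrite !PoszM; ring.
by apply: (dvdz_eqr h2); rewrite nE; rewrite !PoszM; ring.
Qed.

Lemma intr_cohomologous (a b c d : int) :
    cohomologous dia (a%:~R, b%:~R) (c%:~R, d%:~R) ->
  exists t, (m %| a - c + A%:Z * B%:Z * s%:Z * t)%Z /\
            (m %| b - d - B%:Z * C%:Z * t)%Z.
Proof.
case=> t0; have [t ->] := Zp_int t0; rewrite gE /= pmulrn [n%:R]pmulrn.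
have -> : 1 - (1 + (A * B * s)%N%:~R) = (- (A * B * s)%:Z)%:~R :> 'Z_m.
  by rewrite intrN; ring.
rewrite -!intrM -!intrD => -[/(Zp_intr_eq _ _ m_gt1) h1 /(Zp_intr_eq _ _ m_gt1) h2].
exists t; split.
  by apply: (dvdz_eqr h1); rewrite !PoszM; ring.
by apply: (dvdz_eqr h2); rewrite nE; rewrite !PoszM; ring.
Qed.

Lemma param_intr (a b : int) :
    (A%:Z %| a)%Z -> (m %| A%:Z * B%:Z * s%:Z * b)%Z ->
  cocycle_param dia (a%:~R, b%:~R).
Proof.
move=> /dvdzP[a' ->] h; apply/paramE; rewrite gE /= addrAC subrr add0r.
split; rewrite pmulrn -intrM; apply/(Zp_intr_eq _ 0) => //; rewrite subr0.
  by apply/dvdzP; exists a'; rewrite mE nE !PoszM; ring.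
by rewrite !PoszM.
Qed.

(** Cocycle parameters are (A w, C v), and a coboundary adds (-ABs t, BC t). Choosing t reduces v
    modulo B to z_2, which leaves t free up to multiples of A only; as C divides A, such t change
    the first coordinate by multiples of m, so w counts modulo n. The shift by s z_2 is a change of
    coordinates. *)
Lemma complete_family_dvdCA : (C %| A)%N ->
  complete_family dia
    [set (A%:R * (z1%:R - s%:R * z2%:R), (C * z2)%:R) | z1 : 'I_n, z2 : 'I_B].
Proof.
have [A_gt0 B_gt0 C_gt0] := ABC_gt0; have [A0 B0 C0] := ABC_neq0.
have mZ : m%:Z = A%:Z * B%:Z * C%:Z by rewrite mE !PoszM.
have nZ : n%:Z = B%:Z * C%:Z by rewrite nE !PoszM.
have pairE (z1 z2 : nat) : (A%:R * (z1%:R - s%:R * z2%:R), (C * z2)%:R)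
    = ((A%:Z * (z1%:Z - s%:Z * z2%:Z))%:~R, (C%:Z * z2%:Z)%:~R) :> 'Z_m * 'Z_m.
  by congr (_, _); rewrite !(intrM, intrB) ?natrM !pmulrn.
case/dvdnP=> A' AE; have AZ : A%:Z = A'%:Z * C%:Z by rewrite AE PoszM.
apply: complete_family_cohomologous => //.
- move=> _ /imset2P[z1 z2 _ _ ->]; rewrite pairE; apply: param_intr.
    exact: dvdz_mulr.
  apply/dvdzP; exists (s%:Z * z2%:Z); rewrite mZ; ring.
- move=> [f0 gam] /paramE[/annA/= [w ->]].
  rewrite gE addrAC subrr add0r => /annC[v ->].
  have [z2 [t vE]] := int_ord_repr v B_gt0.
  have [z1 [d wE]] := int_ord_repr (w + B%:Z * s%:Z * t + s%:Z * z2%:Z) (ltnW n_gt1).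
  exists (A%:R * (z1%:R - s%:R * z2%:R), (C * z2)%:R); first exact: imset2_f.
  rewrite pairE; apply: (cohomologous_intr (t := t)).
    apply/dvdzP; exists d; rewrite mZ; rewrite nZ in wE.
    transitivity (A%:Z * (w + B%:Z * s%:Z * t + s%:Z * z2%:Z - z1%:Z)).
      by ring.
    by rewrite wE; ring.
  by rewrite vE; apply/dvdzP; exists 0; ring.
move=> _ _ /imset2P[z1 z2 _ _ ->] /imset2P[y1 y2 _ _ ->].
rewrite !pairE => /intr_cohomologous[t []]; rewrite mZ.
case/dvdzP=> d1 e1 /dvdzP[d2 e2].
have {}e2 : z2%:Z - y2%:Z = B%:Z * (t + A%:Z * d2).
  apply: (mulfI C0); transitivity
      (C%:Z * z2%:Z - C%:Z * y2%:Z - B%:Z * C%:Z * t + B%:Z * C%:Z * t).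
    by ring.
  by rewrite e2; ring.
have z2E : z2 = y2.
  by apply: dvdz_ord_inj; rewrite e2; apply: dvdz_mulr.
rewrite {}z2E in e1 e2 *.
have tE : t = - A%:Z * d2.
  move/esym/eqP: e2; rewrite subrr mulf_eq0 (negPf B0) /= addr_eq0 => /eqP->.
  by rewrite mulNr.
suff -> : z1 = y1 by [].
apply: dvdz_ord_inj; apply/dvdzP; exists (d1 + A'%:Z * s%:Z * d2).
apply: (mulfI A0); rewrite nZ.
transitivity (d1 * (A%:Z * B%:Z * C%:Z) - A%:Z * B%:Z * s%:Z * t).
  by rewrite -e1; ring.
by rewrite tE [in RHS]AZ [in LHS]AZ; ring.
Qed.

(** Here t is spent on the first coordinate: s being invertible modulo n, w / s is reduced modulo B
    to z_1. The t still allowed are the multiples of C, and as A divides C they change the second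
    coordinate by multiples of m; hence v counts modulo m / C = D. The shift by z_1 is a change of
    coordinates. *)
Lemma complete_family_dvdAC D : (A %| C)%N -> D = (A * B)%N -> coprime n s ->
  complete_family dia
    [set ((A * s * z1)%:R, C%:R * (z2%:R - z1%:R)) | z1 : 'I_B, z2 : 'I_D].
Proof.
have [A_gt0 B_gt0 C_gt0] := ABC_gt0; have [A0 B0 C0] := ABC_neq0.
have mZ : m%:Z = A%:Z * B%:Z * C%:Z by rewrite mE !PoszM.
have nZ : n%:Z = B%:Z * C%:Z by rewrite nE !PoszM.
have pairE (z1 z2 : nat) : ((A * s * z1)%:R, C%:R * (z2%:R - z1%:R))
    = ((A%:Z * s%:Z * z1%:Z)%:~R, (C%:Z * (z2%:Z - z1%:Z))%:~R) :> 'Z_m * 'Z_m.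
  by congr (_, _); rewrite !(intrM, intrB) ?natrM !pmulrn.
case/dvdnP=> C' CE DE co; have CZ : C%:Z = C'%:Z * A%:Z by rewrite CE PoszM.
have DZ : D%:Z = A%:Z * B%:Z by rewrite DE PoszM.
have D_gt0 : (0 < D)%N by rewrite DE muln_gt0 A_gt0.
apply: complete_family_cohomologous => //.
- move=> _ /imset2P[z1 z2 _ _ ->]; rewrite pairE; apply: param_intr.
    by rewrite -mulrA dvdz_mulr.
  apply/dvdzP; exists (s%:Z * (z2%:Z - z1%:Z)); rewrite mZ; ring.
- move=> [f0 gam] /paramE[/annA/= [w ->]].
  rewrite gE addrAC subrr add0r => /annC[v ->].
  (* [s'] is an inverse of [s] modulo [n]. *)
  have [[k s'] /= sE] : exists uv, uv.1 * n%:Z + uv.2 * s%:Z = 1.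
    by apply/coprimezP; rewrite coprimezE !absz_nat.
  have [z1 [t wE]] := int_ord_repr (s' * w) B_gt0.
  have [z2 [d vE]] := int_ord_repr (v + z1%:Z + B%:Z * t) D_gt0.
  exists ((A * s * z1)%:R, C%:R * (z2%:R - z1%:R)); first exact: imset2_f.
  rewrite pairE; apply: (cohomologous_intr (t := - t)).
    apply/dvdzP; exists (k * w); rewrite mZ; rewrite nZ in sE.
    transitivity (A%:Z * w * (1 - s' * s%:Z) + A%:Z * s%:Z * (s' * w - z1%:Z - B%:Z * t)).
      by ring.
    by rewrite wE -sE; ring.
  apply/dvdzP; exists d; rewrite mZ; rewrite DZ in vE.
  transitivity (C%:Z * (v + z1%:Z + B%:Z * t - z2%:Z)); first by ring.
  by rewrite vE; ring.
move=> _ _ /imset2P[z1 z2 _ _ ->] /imset2P[y1 y2 _ _ ->].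
rewrite !pairE => /intr_cohomologous[t []] h1 h2.
(* Dividing by A turns m into n, and then s cancels by coprimality; modulo B this gives z_1, and
   afterwards it shows that C divides t. *)
have {}h1 : (n %| z1%:Z - y1%:Z + B%:Z * t)%Z.
  rewrite -(@Gauss_dvdzr _ s) ?coprimezE // -(dvdz_mul2l A0).
  by rewrite nZ !mulrA -mZ; apply: (dvdz_eqr h1); ring.
have z1E : z1 = y1.
  apply: dvdz_ord_inj; have BD : (B %| n%:Z)%Z by rewrite nZ dvdz_mulr.
  have -> : z1%:Z - y1%:Z = z1%:Z - y1%:Z + B%:Z * t - B%:Z * t by ring.
  by rewrite rpredB ?(dvdz_trans BD h1) // dvdz_mulr.
rewrite {}z1E in h1 h2 *; rewrite subrr add0r nZ dvdz_mul2l // in h1.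
suff -> : z2 = y2 by [].
apply: dvdz_ord_inj; rewrite DZ; case/dvdzP: h1 h2 => t' -> /dvdzP[d h2].
apply/dvdzP; exists (d + C'%:Z * t'); apply: (mulfI C0).
transitivity (d * m%:Z + B%:Z * C%:Z * (t' * C%:Z)); first by rewrite -h2; ring.
by rewrite mZ [X in t' * X]CZ; ring.
Qed.

(** As C divides A, A^2 B is a multiple of m, so q kills all multiples of A: in particular q itself,
    which makes the action affine in h, and every f_0 of the family, which makes f bilinear in
    representatives. *)
Lemma sqr_dvdCA (x : int) : (C %| A)%N -> (A * B * s)%:R * (A%:Z * x)%:~R = 0 :> 'Z_m.
Proof.
case/dvdnP => A' AE; rewrite pmulrn -intrM; apply/(Zp_intr_eq _ 0) => //.
rewrite subr0; apply/dvdzP; exists (s%:Z * A'%:Z * x).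
have AZ : A%:Z = A'%:Z * C%:Z by rewrite AE PoszM.
by rewrite mE !PoszM {2}AZ; ring.
Qed.

Lemma zact_dvdCA h y : (C %| A)%N -> dia h y = y + (A * B * s * h)%:R * y.
Proof.
move=> CA; rewrite (zactE dia) gE exprD1_sqr0; first by rewrite !natrM; ring.
have -> : (A * B * s)%:R * (A * B * s)%:R = 0 :> 'Z_m.
  rewrite -{2}mulnA [X in _ * X]natrM !pmulrn -intrM.
  by rewrite -pmulrn sqr_dvdCA.
by rewrite mul0r.
Qed.

Lemma ff_dvdCA (x : int) h h' : (C %| A)%N ->
  ff dia (A%:Z * x)%:~R h h' = (A%:Z * x)%:~R * h%:R * h'%:R.
Proof.
move=> CA; rewrite ffE gE geom_mul_eq0 ?sqr_dvdCA //.
by rewrite [h%:R * _]mulrC.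
Qed.

End Families.

(** * Prime powers: the form of the action and the decoupled cocycle conditions *)

Lemma Zp_annihilator m A B C s (y : 'Z_m) :
    (1 < m)%N -> m = (A * B * C)%N -> coprime C s ->
  (A * B * s)%:R * y = 0 -> exists v : int, y = (C%:Z * v)%:~R.
Proof.
move=> m_gt1 mE co; have [_ _ C0] := ABC_neq0 m_gt1 mE.
have [A0 B0 _] := ABC_neq0 m_gt1 mE; have [k ->] := Zp_int y.
rewrite pmulrn -intrM => /(Zp_intr_eq _ 0 m_gt1).
rewrite subr0 mE !PoszM -!mulrA !dvdz_mul2l // Gauss_dvdzr ?coprimezE //.
by case/dvdzP => v ->; exists v; rewrite mulrC.
Qed.

Lemma Zp_coprime_mul_eq0 m c (y : 'Z_m) :
  (1 < m)%N -> coprime m c -> c%:R * y = 0 -> y = 0.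
Proof.
move=> m_gt1; rewrite -unitZpE // => uc cy.
by apply: (mulrI uc); rewrite mulr0.
Qed.

Section PrimePower.

Variables (p eta r : nat).
Hypotheses (p_pr : prime p) (eta_gt0 : (0 < eta)%N) (lt_eta_r : (eta < r)%N).
Variable dia : zmodAction 'Z_(p ^ eta) 'Z_(p ^ r).

Lemma ltn1_prime_exp j : (0 < j)%N -> (1 < p ^ j)%N.
Proof. by move=> j_gt0; rewrite -{1}(expn0 p) ltn_exp2l ?prime_gt1. Qed.

Let n_gt1 := ltn1_prime_exp eta_gt0.
Let m_gt1 : (1 < p ^ r)%N := ltn1_prime_exp (leq_ltn_trans (leq0n eta) lt_eta_r).

Lemma zact_one_form : (p = 2 -> eta = 1 /\ r = 2)%N ->
  exists2 k, (k < p ^ eta)%N & dia 1 1 = 1 + (p ^ (r - eta) * k)%:R.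
Proof.
move=> p_two; set a : nat := dia 1 1.
have lt_a : (a < p ^ r)%N := ltn_Zp m_gt1 _.
have a_n : (a ^ (p ^ eta) = 1 %[mod p ^ r])%N.
  have := congr1 (@nat_of_ord _) (zact_exp_order n_gt1 dia).
  by rewrite -(natr_Zp (dia 1 1)) -natrX val_Zp_nat // => ->; rewrite modn_small.
have a_gt0 : (0 < a)%N.
  rewrite lt0n; apply/eqP => a0; move: a_n; rewrite a0 exp0n ?expn_gt0 ?prime_gt0 //.
  by rewrite mod0n modn_small.
have dv : (p ^ (r - eta) %| a.-1)%N.
  (* Lifting the exponent handles odd p; for p = 2 the modulus is 4 and the residues are inspected
     one by one. *)
  have [p2|p_odd] := even_prime p_pr; last first.
    by apply: (@dvdn_pred_expn_eq1 p a eta r).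
  have [e1 r2] := p_two p2; move: a_n lt_a a_gt0; rewrite p2 e1 r2 !expn1 /=.
  by case: (a) => [|[|[|[|]]]].
exists (a.-1 %/ p ^ (r - eta))%N.
  rewrite ltn_divLR ?expn_gt0 ?prime_gt0 // -expnD subnKC ?(ltnW lt_eta_r) //.
  by rewrite (leq_ltn_trans (leq_pred a)).
by rewrite mulnC divnK // nat1r prednK // natr_Zp.
Qed.

Variable k : nat.
Hypothesis gE : dia 1 1 = 1 + (p ^ (r - eta) * k)%:R.

Lemma cocycle_param_odd l : odd p -> cocycle_param dia l <->
  (p ^ eta)%:R * l.1 = 0 /\ (dia 1 1 - 1) * l.2 = 0.
Proof.
move=> p_odd; have [w geomE co] : exists2 w,
    \sum_(i < p ^ eta) dia 1 1 ^+ i = (p ^ eta * w)%:R & coprime (p ^ r) w.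
  have natE : \sum_(i < p ^ eta) dia 1 1 ^+ i
      = (\sum_(i < p ^ eta) (1 + p ^ (r - eta) * k) ^ i)%N%:R.
    by rewrite gE nat1r natr_sum; apply: eq_bigr => i _; rewrite natrX add1n.
  (* For k = 0 there is no valuation to lift: the sum is p^eta itself and the unit is 1. *)
  rewrite natE; case: (posnP k) => [->|k_gt0].
    exists 1%N; last exact: coprimen1.
    by congr _%:R; rewrite muln0 addn0; under eq_bigr do rewrite exp1n;
       rewrite sum1_card card_ord muln1.
  have [w co kE] := pfactor_coprime p_pr k_gt0.
  have pw : ~~ (p %| w)%N by rewrite -prime_coprime.
  have e_gt0 : (0 < r - eta + logn p k)%N by rewrite addn_gt0 subn_gt0 lt_eta_r.
  have [w' E pw'] := geom_prime_power eta p_pr p_odd e_gt0 pw.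
  exists w'; last by rewrite coprimeXl // prime_coprime.
  by rewrite -E {1}kE expnD -mulnA (mulnC w).
rewrite /cocycle_param geomE natrM; split=> [[e1 e2]|[e1 e2]].
  have {}e2 : (p ^ eta)%:R * l.1 = 0.
    by apply: (Zp_coprime_mul_eq0 m_gt1 co); rewrite mulrA [w%:R * _]mulrC.
  by move: e1; rewrite e2 add0r.
by rewrite e1 e2 addr0 mulrAC e1 mul0r.
Qed.

(** For the trivial action the norm is multiplication by n whatever the prime, so the case k = 0 is
    also settled for p = 2. *)
Lemma cocycle_param_triv l : k = 0%N -> cocycle_param dia l <->
  (p ^ eta)%:R * l.1 = 0 /\ (dia 1 1 - 1) * l.2 = 0.
Proof.
move=> k0; have g1 : dia 1 1 = 1 by rewrite gE k0 muln0 addr0.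
have geom1 : \sum_(i < p ^ eta) dia 1 1 ^+ i = (p ^ eta)%:R.
  by under eq_bigr do rewrite g1 expr1n; rewrite sumr_const card_ord.
by rewrite /cocycle_param geom1 g1 subrr !mul0r addr0; split=> -[].
Qed.

Lemma zact_binomial u s h y : k = (p ^ u * s)%N ->
  dia h y = \sum_(0 <= i < h.+1)
              ('C(h, i) * p ^ ((r - eta + u) * i) * s ^ i)%:R * y.
Proof.
move=> kE; rewrite zactE gE exprDn mulr_suml big_mkord; apply: eq_bigr => i _.
rewrite expr1n mul1r -natrX kE mulnA -expnD expnMn -expnM -mulr_natl -natrM.
by rewrite mulnA.
Qed.

Lemma ff_binomial u s f0 h h' : k = (p ^ u * s)%N ->
  ff dia f0 h h' = \sum_(0 <= i < h)
     (p ^ ((r - eta + u) * i) * s ^ i * 'C(h, i.+1))%:R * f0 * h'%:R.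
Proof.
move=> kE; rewrite ffE gE geom_binomial !mulr_suml; apply: eq_bigr => i _.
by rewrite -natrX kE mulnA -expnD expnMn -expnM -mulr_natr -natrM.
Qed.

End PrimePower.

(** * The nontrivial action for p = 2, on Z/4 *)

Section PrimeTwo.

Variable dia : zmodAction 'Z_(2 ^ 1) 'Z_(2 ^ 2).
Hypothesis gE : dia 1 1 = 1 + (2 ^ (2 - 1) * 1)%:R.

(** Coboundaries are (-2t, 2t), so they preserve f_0 + gamma, which is even on cocycles. A class is
    thus given by gamma modulo 2, which is z_2, and by f_0 + gamma = 2 z_1 in Z/4. *)
Lemma complete_family_two :
  complete_family dia [set (2 * z1%:R - z2%:R, z2%:R) | z1 : 'I_2, z2 : 'I_2].
Proof.
have n_gt1 : (1 < 2 ^ 1)%N by [].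
have m_gt1 : (1 < 2 ^ 2)%N by [].
(* The shape A = 2, B = 1, C = 2, s = 1 gives access to the integer form of [cohomologous]. *)
have gE' : dia 1 1 = 1 + (2 * 1 * 1)%:R by rewrite gE.
have nE : (2 ^ 1 = 1 * 2)%N by [].
have pairE (z1 z2 : nat) : (2 * z1%:R - z2%:R, z2%:R)
    = ((2 * z1%:Z - z2%:Z)%:~R, (z2%:Z)%:~R) :> 'Z_(2 ^ 2) * 'Z_(2 ^ 2).
  by congr (_, _); rewrite !(intrM, intrB) ?natrM ?pmulrn.
have paramE (a b : int) : cocycle_param dia (a%:~R, b%:~R) <-> (2 %| a + b)%Z.
  rewrite /cocycle_param gE' /=.
  have -> : \sum_(i < 2 ^ 1) (1 + (2 * 1 * 1)%:R) ^+ i = 0 :> 'Z_(2 ^ 2).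
    by rewrite !big_ord_recl big_ord0; apply/val_inj.
  rewrite mul0r; have -> : (2 ^ 1)%:R * a%:~R + (1 + (2 * 1 * 1)%:R - 1) * b%:~R
      = (2 * (a + b))%:~R :> 'Z_(2 ^ 2) by rewrite intrM intrD; ring.
  have -> : (2 %| a + b)%Z = ((2 ^ 2)%N %| 2 * (a + b) - 0)%Z.
    by rewrite subr0 (dvdz_mul2l (d := 2)).
  by split=> [[/(Zp_intr_eq _ 0 m_gt1)]|/(Zp_intr_eq _ 0 m_gt1)].
apply: complete_family_cohomologous => //.
- move=> _ /imset2P[z1 z2 _ _ ->]; rewrite pairE; apply/paramE.
  by apply/dvdzP; exists z1%:Z; ring.
- move=> [f0 gam]; have [w ->] := Zp_int f0; have [v ->] := Zp_int gam.
  case/paramE/dvdzP => d wvE.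
  have [z2 [t vE]] := @int_ord_repr 2 v isT.
  have [z1 [e dE]] := @int_ord_repr 2 d isT.
  exists (2 * z1%:R - z2%:R, z2%:R); first exact: imset2_f.
  rewrite pairE; apply: (cohomologous_intr m_gt1 nE gE' (t := t)).
    apply/dvdzP; exists e; transitivity (w + v - v + z2%:Z - 2 * z1%:Z + 2 * t).
      by ring.
    by rewrite wvE vE dE; ring.
  by apply/dvdzP; exists 0; rewrite vE; ring.
move=> _ _ /imset2P[z1 z2 _ _ ->] /imset2P[y1 y2 _ _ ->].
rewrite !pairE => /(intr_cohomologous m_gt1 nE gE')[t [/dvdzP[d1 e1] /dvdzP[d2 e2]]].
have zE2 : z2 = y2.
  apply: dvdz_ord_inj; apply/dvdzP; exists (t + 2 * d2).
  transitivity (z2%:Z - y2%:Z - 1%:Z * 2%:Z * t + 2 * t); first by ring.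
  by rewrite e2; ring.
rewrite {}zE2 in e1 e2 *; suff -> : z1 = y1 by [].
apply: dvdz_ord_inj; apply/dvdzP; exists (d1 + d2).
apply: (@mulfI _ 2) => //.
transitivity (2 * z1%:Z - y2%:Z - (2 * y1%:Z - y2%:Z) + 2%:Z * 1%:Z * 1%:Z * t
  + (y2%:Z - y2%:Z - 1%:Z * 2%:Z * t)); first by ring.
by rewrite e1 e2; ring.
Qed.

(** Only h = 0 and h = 1 occur, and 3^h = 1 + 2h for both. *)
Lemma zact_two h y : dia h y = (1 + 2 * h%:R) * y.
Proof.
rewrite zactE gE; have := ltn_Zp (isT : (1 < 2 ^ 1)%N) h.
by case: (nat_of_ord h) => [|[|//]] _; ring.
Qed.

Lemma ff_two f0 h h' : ff dia f0 h h' = f0 * h%:R * h'%:R.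
Proof.
rewrite ffE; have := ltn_Zp (isT : (1 < 2 ^ 1)%N) h.
by case: (nat_of_ord h) => [|[|//]] _; rewrite ?big_ord0 ?big_ord1; ring.
Qed.

End PrimeTwo.
Theorem proposition4p6 (p eta r : nat)
  (p_prime : prime p) (eta_ge1 : (1 <= eta)%N) (r_ge1 : (1 <= r)%N)
  (p_odd : odd p -> (eta < r)%N) (p_two : p = 2%N -> eta = 1%N /\ r = 2%N)
  (dia : zmodAction 'Z_(p ^ eta) 'Z_(p ^ r)) :
  exists k : nat,
  [/\ (k < p ^ eta)%N,
      (forall (h : 'Z_(p ^ eta)) (y : 'Z_(p ^ r)),
         dia h y = (1 + (p ^ (r - eta) * k)%:R) ^+ h * y),
      (k = 0%N ->
         let Lambda : {set 'Z_(p ^ r) * 'Z_(p ^ r)} :=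
           [set ((p ^ (r - eta) * z1)%:R, z2%:R)
              | z1 : 'I_(p ^ eta), z2 : 'I_(p ^ eta)] in
         complete_family dia Lambda /\
         (forall l (h h' : 'Z_(p ^ eta)), l \in Lambda ->
            ff dia l.1 h h' = l.1 * h%:R * h'%:R))
    & (k <> 0%N ->
       exists u s : nat,
       [/\ k = (p ^ u * s)%N, (u < eta)%N, ~~ (p %| s)%N,
           ((2 * eta <= r + u)%N ->
              (p <> 2%N ->
                 let Lambda : {set 'Z_(p ^ r) * 'Z_(p ^ r)} :=
                   [set ((p ^ (r - eta))%:R * (z1%:R - s%:R * z2%:R),
                         (p ^ (eta - u) * z2)%:R)
                      | z1 : 'I_(p ^ eta), z2 : 'I_(p ^ u)] in
                 [/\ complete_family dia Lambda,
                     (forall (h : 'Z_(p ^ eta)) (y : 'Z_(p ^ r)),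
                        dia h y = y + (p ^ (r - eta + u) * s * h)%:R * y)
                   & (forall l (h h' : 'Z_(p ^ eta)), l \in Lambda ->
                        ff dia l.1 h h' = l.1 * h%:R * h'%:R)]) /\
              (p = 2%N ->
                 let Lambda : {set 'Z_(p ^ r) * 'Z_(p ^ r)} :=
                   [set (2 * z1%:R - z2%:R, z2%:R)
                      | z1 : 'I_2, z2 : 'I_2] in
                 [/\ k = 1%N,
                     complete_family dia Lambda,
                     (forall (h : 'Z_(p ^ eta)) (y : 'Z_(p ^ r)),
                        dia h y = (1 + 2 * h%:R) * y)
                   & (forall l (h h' : 'Z_(p ^ eta)), l \in Lambda ->
                        ff dia l.1 h h' = l.1 * h%:R * h'%:R)]))
         & ((r + u < 2 * eta)%N ->
              let Lambda : {set 'Z_(p ^ r) * 'Z_(p ^ r)} :=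
                [set ((p ^ (r - eta) * s * z1)%:R,
                      (p ^ (eta - u))%:R * (z2%:R - z1%:R))
                   | z1 : 'I_(p ^ u), z2 : 'I_(p ^ (r - eta + u))] in
              [/\ p <> 2%N,
                  complete_family dia Lambda,
                  (forall (h : 'Z_(p ^ eta)) (y : 'Z_(p ^ r)),
                     dia h y = \sum_(0 <= i < h.+1)
                       ('C(h, i) * p ^ ((r - eta + u) * i) * s ^ i)%:R * y)
                & (forall l (h h' : 'Z_(p ^ eta)), l \in Lambda ->
                     ff dia l.1 h h' = \sum_(0 <= i < h)
                       (p ^ ((r - eta + u) * i) * s ^ i * 'C(h, i.+1))%:R
                         * l.1 * h'%:R)])])].
Proof.
have lt_eta_r : (eta < r)%N.
  have [p2|] := even_prime p_prime; last exact: p_odd.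
  by have [-> ->] := p_two p2.
have n_gt1 : (1 < p ^ eta)%N := ltn1_prime_exp p_prime eta_ge1.
have m_gt1 : (1 < p ^ r)%N := ltn1_prime_exp p_prime r_ge1.
have [k lt_k gE] := zact_one_form p_prime eta_ge1 lt_eta_r dia p_two.
exists k; split=> // [h y|k0 Lambda|k_neq0].
- by rewrite zactE gE.
(* The trivial action fits the family for C | A with B = p^eta, C = 1 and s = 0. *)
- have gE0 : dia 1 1 = 1 + (p ^ (r - eta) * p ^ eta * 0)%:R.
    by rewrite gE k0 !muln0.
  have nE : (p ^ eta = p ^ eta * 1)%N by rewrite muln1.
  have mE : (p ^ r = p ^ (r - eta) * p ^ eta * 1)%N.
    by rewrite muln1 -expnD subnK // ltnW.
  split.
    have -> : Lambda = [set ((p ^ (r - eta))%:R * (z1%:R - 0%:R * z2%:R),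
                 (1 * z2)%:R) | z1 : 'I_(p ^ eta), z2 : 'I_(p ^ eta)].
      apply: eq_in_imset2 => z1 z2 _ _.
      by rewrite mul0r subr0 natrM mul1n.
    apply: (complete_family_dvdCA n_gt1 m_gt1 nE mE gE0) => //.
      by move=> l; exact: (cocycle_param_triv gE l k0).
    by move=> y _; have [v ->] := Zp_int y; exists v; rewrite mul1r.
  move=> _ h h' /imset2P[z1 z2 _ _ ->] /=.
  rewrite natrM !pmulrn -intrM.
  by rewrite (ff_dvdCA m_gt1 mE gE0).
have k_gt0 : (0 < k)%N by rewrite lt0n; apply/eqP.
have [s co kE] := pfactor_coprime p_prime k_gt0.
set u := logn p k in kE; exists u, s.
have lt_u : (u < eta)%N.
  rewrite -(ltn_exp2l _ _ (prime_gt1 p_prime)); apply: leq_ltn_trans lt_k.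
  by apply: dvdn_leq; rewrite // kE dvdn_mull.
have kE' : k = (p ^ u * s)%N by rewrite mulnC.
have gE' : dia 1 1 = 1 + (p ^ (r - eta) * p ^ u * s)%:R by rewrite gE kE' mulnA.
have nE : (p ^ eta = p ^ u * p ^ (eta - u))%N by rewrite -expnD subnKC // ltnW.
have mE : (p ^ r = p ^ (r - eta) * p ^ u * p ^ (eta - u))%N.
  by rewrite -mulnA -nE -expnD subnK // ltnW.
have annC y := @Zp_annihilator _ _ _ _ _ y m_gt1 mE (coprimeXl _ co).
have paramE l := cocycle_param_odd p_prime lt_eta_r gE l.
have oddP : p <> 2%N -> odd p by case: (even_prime p_prime).
split=> //; first by rewrite -prime_coprime.
- move=> le_2eta; split=> [/oddP odd_p Lambda|p2 Lambda].
    (* The inequality 2 eta <= r + u says that eta - u <= r - eta. *)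
    have CA : (p ^ (eta - u) %| p ^ (r - eta))%N by rewrite dvdn_exp2l //; lia.
    split=> [|h y|l h h' /imset2P[z1 z2 _ _ ->] /=].
    + apply: (complete_family_dvdCA n_gt1 m_gt1 nE mE gE') => // l.
      exact: paramE.
    + by rewrite (zact_dvdCA m_gt1 mE gE') // expnD.
    + have -> : (p ^ (r - eta))%:R * (z1%:R - s%:R * z2%:R)
          = ((p ^ (r - eta))%N%:Z * (z1%:Z - s%:Z * z2%:Z))%:~R :> 'Z_(p ^ r).
        by rewrite intrM intrB intrM !pmulrn.
      by rewrite (ff_dvdCA m_gt1 mE gE').
  have [eta1 r2] := p_two p2; rewrite {}/Lambda.
  have k1 : k = 1%N.
    by apply/anti_leq; rewrite k_gt0 andbT -ltnS; move: lt_k; rewrite p2 eta1.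
  (* The action is generalized because its type depends on p, eta and r, which are replaced by
     numerals. *)
  clear paramE annC gE'; move: dia gE; rewrite k1 p2 eta1 r2 => dia' gE1.
  split=> // [|h y|l h h' _].
  + exact: complete_family_two.
  + exact: zact_two.
  + exact: ff_two.
move=> lt_2eta Lambda.
(* For p = 2, 2 eta = r = 2 contradicts r + u < 2 eta. *)
have p_neq2 : p <> 2%N by move=> /p_two[e1 r2]; lia.
split=> // [|h y|l h h' _].
- apply: (complete_family_dvdAC n_gt1 m_gt1 nE mE gE') => //.
  + by move=> l; apply/paramE/oddP.
  + by rewrite dvdn_exp2l //; lia.
  + by rewrite expnD.
  + exact: coprimeXl.
- exact: zact_binomial kE'.
- exact: ff_binomial kE'.
Qed.
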